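(* Let $\mu$ be the Markov measure on $X^{\mathbb N}$ defined by an irreducible stochastic matrix $L$ (with its stationary probability vector $\boldsymbol{l}$). Suppose a transformation $g:X^{\mathbb N}\to X^{\mathbb N}$ is generated by an automaton $\mathcal A=(X,S,\pi,\lambda)$. If the automaton $\mathcal A$ is $L$-strongly connected, then for any nonempty word $u=u_1u_2\ldots u_k\in X^*$ and $\mu$-almost all $\omega\in X^{\mathbb N}$, $$\lim_{n\to\infty}\frac1n\sum_{i=0}^{n-1}\chi_{uX^{\mathbb N}}(\sigma^i g(\omega))=\sum_{\substack{s_0\in S,\ x_0,\dots,x_{k-1}\in X:\\ \lambda(s_0,\,x_0x_1\ldots x_{k-1})=u}}\boldsymbol{t}_{(s_0,x_0)}L_{x_0x_1}\cdots L_{x_{k-2}x_{k-1}},$$ where $\boldsymbol{t}$ is the (unique) stationary probability vector of the stochastic matrix $T_{L,\mathcal A}$.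
   Context: $X$ is a finite set (alphabet) with more than one element, $X^*$ the set of finite words over $X$ (including the empty word), $X^{\mathbb N}$ the set of infinite sequences over $X$ with the product topology; for $w\in X^*$, $wX^{\mathbb N}$ is the set of sequences with prefix $w$; $\chi_E$ is the characteristic function of $E$; $\sigma$ is the shift, $(\sigma(\omega))_n=\omega_{n+1}$. Markov measure: given a stochastic matrix $L=(L_{xy})_{x,y\in X}$ and a stationary probability vector $\boldsymbol{l}$ ($\boldsymbol{l}L=\boldsymbol{l}$), it is the Borel probability measure with $\mu(x_1\ldots x_nX^{\mathbb N})=\boldsymbol{l}_{x_1}L_{x_1x_2}\cdots L_{x_{n-1}x_n}$. An automaton $\mathcal A=(X,S,\pi,\lambda)$ consists of the alphabet $X$, a nonempty finite set $S$ of states, a transition function $\pi:S\times X\to S$ and an output function $\lambda:S\times X\to X$. These are extended to words: $\pi(s,\varnothing)=s$, $\pi(s,xw)=\pi(\pi(s,x),w)$, and $\lambda(s,\varnothing)=\varnothing$, $\lambda(s,xw)=\lambda(s,x)\,\lambda(\pi(s,x),w)$; the latter rule also defines $\lambda(s,\omega)\in X^{\mathbb N}$ for $\omega\in X^{\mathbb N}$. A transformation $g$ of $X^{\mathbb N}$ is generated by $\mathcal A$ if for some (initial) state, also denoted $g\in S$, $g(\omega)=\lambda(g,\omega)$ for all $\omega$. $\mathcal A$ is $L$-strongly connected if for any states $s,r\in S$ and any symbols $x,y\in X$ there is a word $w=w_1\ldots w_n\in X^*$ (possibly empty) such that $\pi(s,xw)=r$ and all transitions between consecutive letters of the word $xwy$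 have nonzero probability, i.e. $L_{xw_1},L_{w_1w_2},\dots,L_{w_{n-1}w_n},L_{w_ny}$ are all nonzero ($L_{xy}\ne0$ if $w$ is empty). The matrix $T_{L,\mathcal A}$ has rows and columns indexed by $S\times X$, with entries $T_{(s_0,x_0)(s_1,x_1)}=L_{x_0x_1}$ if $\pi(s_0,x_0)=s_1$ and $0$ otherwise. It is stochastic. For $k=1$ the product of entries of $L$ in the sum is empty (equal to $1$). *)

(* Defs.v *)
From HB Require Import structures.
From mathcomp Require Import all_boot all_order all_algebra.
From mathcomp Require Import all_classical all_reals all_analysis.

Set Implicit Arguments.
Unset Strict Implicit.
Unset Printing Implicit Defensive.

Import Order.TTheory GRing.Theory Num.Theory.
Import numFieldNormedType.Exports.
Local Open Scope classical_set_scope.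
Local Open Scope ring_scope.

(* Measurable types of the library carry a distinguished point; the point of an
   alphabet serves only this purpose. *)
#[short(type="pointedFinType")]
HB.structure Definition PointedFinite := {T of Finite T & Pointed T}.

Definition infword (X : Type) : Type := {ptws nat -> discrete_topology X}.

HB.instance Definition _ (X : pointedFinType) := Pointed.on (infword X).
HB.instance Definition _ (X : pointedFinType) := Topological.on (infword X).
(* the Borel sigma-algebra of the product topology *)
HB.instance Definition _ (X : pointedFinType) :=
  Measurable.copy (infword X) (g_sigma_algebraType (@open (infword X))).

Definition cylinder (X : Type) (w : seq X) : set (infword X) :=
  [set omega | mkseq omega (size w) = w].

Definition wshift (X : Type) (omega : infword X) : infword X :=
  fun n => omega n.+1.

(* Matrices indexed by a finite type [I] are functions [I -> I -> R]. *)
Section Matrices.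
Context {R : realType} {I : finType}.
Implicit Types (M : I -> I -> R) (v : I -> R).

Definition stochastic M :=
  (forall i j, 0 <= M i j) /\ (forall i, \sum_j M i j = 1).

Definition to_mx M : 'M[R]_#|I| :=
  \matrix_(i, j) M (enum_val i) (enum_val j).

Definition irreducible M :=
  forall i j, exists2 n, (0 < n)%N &
    0 < (to_mx M ^+ n) (enum_rank i) (enum_rank j).

Definition stationary_distribution M v :=
  [/\ forall i, 0 <= v i, \sum_i v i = 1 &
      forall j, \sum_i v i * M i j = v j].

(* M_{w_1 w_2} M_{w_2 w_3} ... ; equal to 1 if [w] has at most one letter *)
Definition transition_prod M (w : seq I) : R :=
  \prod_(p <- zip w (behead w)) M p.1 p.2.

End Matrices.

Definition markov_measure (R : realType) (X : pointedFinType)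
    (L : X -> X -> R) (l : X -> R) (mu : probability (infword X) R) :=
  forall (x : X) (w : seq X),
    mu (cylinder (x :: w)) = (l x * transition_prod L (x :: w))%:E.

Record automaton (X : finType) := Automaton {
  state :> finType ;
  trans : state -> X -> state ;
  out : state -> X -> X ;
  state_gt0 : (0 < #|state|)%N
}.

Section Automata.
Context {X : finType} (A : automaton X).

Fixpoint trans_word (s : A) (w : seq X) : A :=
  if w is x :: w' then trans_word (trans s x) w' else s.

Fixpoint out_word (s : A) (w : seq X) : seq X :=
  if w is x :: w' then out s x :: out_word (trans s x) w' else [::].

(* Closed form of the coinductive rule for [lambda(s, x omega)]; see [out_inf0]
   and [out_infS]. *)
Definition out_inf (s : A) (omega : infword X) : infword X :=
  fun n => out (trans_word s (mkseq omega n)) (omega n).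

Lemma out_inf0 s omega : out_inf s omega 0%N = out s (omega 0%N).
Proof. by []. Qed.

Lemma out_infS s omega n :
  out_inf s omega n.+1 = out_inf (trans s (omega 0%N)) (wshift omega) n.
Proof.
rewrite /out_inf /mkseq /= -[1%N]/(1 + 0)%N iotaDl -map_comp.
by congr (out (trans_word _ _) _).
Qed.

Definition generated_by (g : infword X -> infword X) :=
  exists s : A, forall omega, g omega = out_inf s omega.

Definition strongly_connected {R : realType} (L : X -> X -> R) :=
  forall (s r : A) (x y : X), exists w : seq X,
    trans_word s (x :: w) = r /\
    path (fun a b => L a b != 0) x (rcons w y).

Definition transition_matrix {R : realType} (L : X -> X -> R)
    (p q : A * X) : R :=
  if trans p.1 p.2 == q.1 then L p.2 q.2 else 0.

Lemma transition_matrix_stochastic {R : realType} (L : X -> X -> R) :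
  stochastic L -> stochastic (transition_matrix L).
Proof.
move=> [L0 L1]; split => [p q|p].
  by rewrite /transition_matrix; case: ifP.
rewrite -(pair_bigA _ (fun s x => transition_matrix L p (s, x))) /=.
rewrite (bigD1 (trans p.1 p.2)) //= [X in _ + X]big1 ?addr0; last first.
  move=> s sp; apply: big1 => x _.
  by rewrite /transition_matrix /= eq_sym (negbTE sp).
by rewrite -(L1 p.2); apply: eq_bigr => x _; rewrite /transition_matrix eqxx.
Qed.

End Automata.

(* Main.v *)
Require Import Defs.
From HB Require Import structures.
From mathcomp Require Import all_boot all_order all_algebra.
From mathcomp Require Import all_classical all_reals all_analysis.
From mathcomp Require Import zify ring lra.

Set Implicit Arguments.
Unset Strict Implicit.
Unset Printing Implicit Defensive.

Import Order.TTheory GRing.Theory Num.Theory.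
Import numFieldNormedType.Exports.
Local Open Scope classical_set_scope.
Local Open Scope ring_scope.

(** Feed a word with law [mu] to the automaton, started in the state that
    generates [g].  The pairs (current state, letter being read) form a Markov
    chain on [A * X] with transition matrix [T = transition_matrix L], and the
    occurrence of [u] at position [i] of the output is decided by the state at
    time [i] and the input letters [i], ..., [i + k].  So the theorem is a law
    of large numbers for a function of finitely many consecutive steps of a
    finite Markov chain, and strong connectedness says that this chain is
    irreducible.

    Irreducibility enters through the maximum principle
    ([subharmonic_cst]), which makes the matrix [1 - T + J], where [J] has all
    entries 1, injective and hence invertible.  This one matrix yields both
    the unique stationary vector [t] of [T]
    ([stationary_distribution_unique]) and, for each function [h] on [A * X], a
    solution [v] of the Poisson equation [h = c + v - T v], in which the
    constant [c] is forced to be the [t]-mean of [h] ([poisson_equation],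
    [poisson_mean]).

    Apply this to [h (s, x)], the probability that the output starts with [u]
    when the chain starts at [(s, x)].  Then [c] is the limit announced
    ([sum_word_prob]), and the number of occurrences of [u] up to time [n] is
    [n c], plus a bounded telescoping term, plus a sum of [n] bounded functions
    of windows of [k + 2] letters, each of conditional mean zero given the
    state and the first letter of its window ([centered_count_mean],
    [sum_indic_out_inf]).  Two such functions whose windows share at most one
    letter are orthogonal ([window_term_orthogonal]), so the second moment of
    the sum is at most [K n] ([window_sum_second_moment]).  Chebyshev's
    inequality and the Borel-Cantelli lemma give convergence of the averages
    along the squares, and the bound on the terms fills the gaps between
    consecutive squares ([strong_law_of_deviations]).

    Everything computed under [mu] depends on finitely many letters.  The
    moments are therefore finite weighted sums over words ([path_mean]), and
    [mu] appears only through the probabilities of events on prefixes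
    ([markov_word_event]). *)

(** * Irreducible finite Markov chains *)

Section FiniteChains.
Context {R : realType} {I : finType}.

(** The right inverse solves linear systems, which gives the Poisson equation; the
    left inverse gives stationary vectors. *)
Lemma injective_system_inverse (M : I -> I -> R) :
    (forall v : I -> R, (forall i, \sum_j M i j * v j = 0) -> forall j, v j = 0) ->
  exists N : I -> I -> R,
    (forall i k, \sum_j M i j * N j k = (i == k)%:R) /\
    (forall i k, \sum_j N i j * M j k = (i == k)%:R).
Proof.
move=> injM.
have sumE (f : 'I_#|I| -> R) : \sum_k f k = \sum_i f (enum_rank i).
  by rewrite (reindex enum_rank) //; exact/onW_bij/enum_rank_bij.
have MU : to_mx M \in unitmx.
  rewrite -unitmx_tr -row_free_unit; apply: inj_row_free => v vM0.
  apply/rowP => k; rewrite -(enum_valK k) mxE.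
  apply: (injM (fun i => v 0 (enum_rank i))) => i.
  have := congr1 (fun w : 'rV_#|I| => w 0 (enum_rank i)) vM0.
  rewrite !mxE => vMi; rewrite -[RHS]vMi sumE; apply: eq_bigr => j _.
  by rewrite !mxE !enum_rankK mulrC.
exists (fun i j => invmx (to_mx M) (enum_rank i) (enum_rank j)).
split=> i k.
- have := congr1 (fun A : 'M[R]_(#|I|) => A (enum_rank i) (enum_rank k))
    (mulmxV MU).
  rewrite !mxE (inj_eq enum_rank_inj) => NMik; rewrite -[RHS]NMik sumE.
  by apply: eq_bigr => j _; rewrite !mxE !enum_rankK.
- have := congr1 (fun A : 'M[R]_(#|I|) => A (enum_rank i) (enum_rank k))
    (mulVmx MU).
  rewrite !mxE (inj_eq enum_rank_inj) => NMik; rewrite -[RHS]NMik sumE.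
  by apply: eq_bigr => j _; rewrite !mxE !enum_rankK.
Qed.

Context (T : I -> I -> R).
Hypothesis stochT : stochastic T.
Hypothesis connT : forall i j, connect (fun a b => T a b != 0) i j.

(** Maximum principle: where [v] attains its maximum it is at most a weighted
    mean of values that do not exceed this maximum, so the maximum is attained
    again at all successors, hence everywhere by irreducibility. *)
Lemma subharmonic_cst (v : I -> R) :
  (forall i, v i <= \sum_j T i j * v j) -> forall i j, v i = v j.
Proof.
have [T0 T1] := stochT => subv i0 j0.
pose m := [arg max_(i > i0) v i]%O.
have vle i : v i <= v m by rewrite /m; case: arg_maxP => // a _; exact.
suff vm j : v j = v m by rewrite !vm.
have /connectP[p + ->] := connT m j.
have : v m = v m by [].
(* Equality with the maximum is carried along the path. *)
elim: p {1 3 4}m => [//|b p IHp] a va /= /andP[Tab]; apply: IHp.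
have sum0 : \sum_j T a j * (v m - v j) = 0.
  apply/le_anti/andP; split; last first.
    by apply: sumr_ge0 => k _; rewrite mulr_ge0 ?subr_ge0.
  under eq_bigr do rewrite mulrBr.
  by rewrite sumrB -mulr_suml T1 mul1r subr_le0 -va.
have nneg k : true -> 0 <= T a k * (v m - v k).
  by move=> _; rewrite mulr_ge0 ?subr_ge0.
have /eqP := psumr_eq0P nneg sum0 isT (i := b).
by rewrite mulf_eq0 (negbTE Tab) /= subr_eq0 => /eqP.
Qed.

Let harmonic_cst (v : I -> R) : (forall i j, v i = v j) ->
  forall i, \sum_j T i j * v j = v i.
Proof.
move=> vC i; under eq_bigr => j _ do rewrite (vC j i).
by rewrite -mulr_suml (proj2 stochT) mul1r.
Qed.

(** [1 - T + J], with [J] the matrix all of whose entries are 1: the term [J]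
    removes the constants from the kernel of [1 - T]. *)
Let M i j := (i == j)%:R - T i j + 1.

Let ME (v : I -> R) i :
  \sum_j M i j * v j = v i - \sum_j T i j * v j + \sum_j v j.
Proof.
rewrite /M; under eq_bigr do rewrite mulrDl mulrBl mul1r.
rewrite big_split sumrB /=; congr (_ - _ + _).
rewrite (bigD1 i) //= eqxx mul1r big1 ?addr0 // => j.
by rewrite eq_sym => /negbTE ->; rewrite mul0r.
Qed.

Let M_inj (v : I -> R) :
  (forall i, \sum_j M i j * v j = 0) -> forall j, v j = 0.
Proof.
move=> Mv0 j0; pose s := \sum_j v j.
(* [v - T v] is a constant, so [v] or [- v] is subharmonic. *)
have vE i : v i - \sum_j T i j * v j = - s.
  by apply/eqP; rewrite -addr_eq0 -ME Mv0.
have vC : forall i j, v i = v j.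
  case: (leP 0 s) => s0.
    by apply: subharmonic_cst => i; rewrite -subr_le0 vE oppr_le0.
  move=> i j; apply: oppr_inj; move: i j.
  apply: (@subharmonic_cst (fun i => - v i)) => i.
  under eq_bigr do rewrite mulrN.
  by rewrite sumrN lerN2 -subr_ge0 vE oppr_ge0 ltW.
have /eqP := vE j0.
rewrite (harmonic_cst vC) subrr eq_sym oppr_eq0 /s.
under eq_bigr do rewrite (vC _ j0).
rewrite sumr_const -mulr_natr mulf_eq0 => /orP[/eqP //|].
by rewrite pnatr_eq0 -leqn0 leqNgt; case/negP; apply/card_gt0P; exists j0.
Qed.

(** The solution [v] of [M v = h] has [v - T v + \sum_j v j = h], so the
    constant is the sum of the entries of [v]. *)
Lemma poisson_equation (h : I -> R) : exists (c : R) (v : I -> R),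
  forall i, h i = c + (v i - \sum_j T i j * v j).
Proof.
have [N [MN _]] := injective_system_inverse M_inj.
pose v j := \sum_k N j k * h k.
exists (\sum_j v j), v => i; rewrite addrC -ME /v.
under eq_bigr do rewrite mulr_sumr; rewrite exchange_big /=.
under eq_bigr => k _.
  under eq_bigr do rewrite mulrA. rewrite -mulr_suml MN. over.
rewrite (bigD1 i) //= eqxx mul1r big1 ?addr0 // => j.
by rewrite eq_sym => /negbTE ->; rewrite mul0r.
Qed.

Lemma poisson_mean (t : I -> R) (c : R) (h v : I -> R) :
    \sum_i t i = 1 -> (forall j, \sum_i t i * T i j = t j) ->
    (forall i, h i = c + (v i - \sum_j T i j * v j)) ->
  \sum_i t i * h i = c.
Proof.
move=> t1 tT hE; under eq_bigr do rewrite hE mulrDr mulrBr mulr_sumr.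
rewrite big_split sumrB /= -mulr_suml t1 mul1r exchange_big /=.
under [X in _ - X]eq_bigr => j _.
  under eq_bigr do rewrite mulrA. rewrite -mulr_suml tT. over.
by rewrite subrr addr0.
Qed.

(** If [c < 0 <= h] then [v - T v = h - c > 0], so [- v] is subharmonic, hence
    constant, and [h = c] contradicts the sign of [h]. *)
Lemma poisson_constant_ge0 (c : R) (h v : I -> R) (i0 : I) :
    (forall i, 0 <= h i) ->
    (forall i, h i = c + (v i - \sum_j T i j * v j)) ->
  0 <= c.
Proof.
move=> h0 hE; rewrite leNgt; apply/negP => c0.
have vC : forall i j, v i = v j.
  move=> i j; apply: oppr_inj; move: i j.
  apply: (@subharmonic_cst (fun i => - v i)) => i.
  under eq_bigr do rewrite mulrN.
  rewrite sumrN lerN2 -subr_ge0 -(lerD2l c) -hE addr0.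
  by rewrite (le_trans (ltW c0)).
by have := h0 i0; rewrite hE (harmonic_cst vC) subrr addr0 leNgt c0.
Qed.

(** The row vector of column sums of [M^-1] solves [t M = (1, ..., 1)].  Summing
    the entries of this identity gives total mass 1, and then it reads
    [t T = t].  The value of [t] at [j] is the mean of the indicator of [j],
    which is the Poisson constant of that indicator: this gives positivity and
    uniqueness at once. *)
Lemma stationary_distribution_unique (i0 : I) :
  exists t : I -> R, unique (stationary_distribution T) t.
Proof.
have [N [_ NM]] := injective_system_inverse M_inj.
pose t i := \sum_k N k i; exists t.
have card0 : #|I|%:R != 0 :> R.
  by rewrite pnatr_eq0 -lt0n; apply/card_gt0P; exists i0.
have tM i : t i - \sum_k t k * T k i + \sum_k t k = 1.
  transitivity (\sum_k t k * M k i).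
    rewrite /M; under [RHS]eq_bigr do rewrite mulrDr mulrBr mulr1.
    rewrite big_split sumrB /=; congr (_ - _ + _).
    rewrite (bigD1 i) //= eqxx mulr1 big1 ?addr0 // => j.
    by move=> /negbTE ->; rewrite mulr0.
  rewrite /t; under eq_bigr do rewrite mulr_suml; rewrite exchange_big /=.
  under eq_bigr do rewrite NM.
  by rewrite (bigD1 i) //= eqxx big1 ?addr0 // => j /negbTE ->.
have t1 : \sum_i t i = 1.
  apply: (mulIf card0); rewrite mul1r.
  have : \sum_i (t i - \sum_k t k * T k i + \sum_k t k) = #|I|%:R.
    by under eq_bigr do rewrite tM; rewrite sumr_const.
  rewrite big_split sumrB /= sumr_const mulr_natr => sumN.
  rewrite -[RHS]sumN.
  suff -> : \sum_i \sum_k t k * T k i = \sum_k t k by rewrite subrr add0r.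
  rewrite exchange_big; apply: eq_bigr => k _.
  by rewrite -mulr_sumr (proj2 stochT) mulr1.
have tT j : \sum_i t i * T i j = t j.
  by apply/esym/eqP; rewrite -subr_eq0 -(addrK 1 (_ - _)) -[X in _ + X - _]t1 tM subrr.
have pickE (s : I -> R) j : s j = \sum_i s i * (i == j)%:R.
  rewrite (bigD1 j) //= eqxx mulr1 big1 ?addr0 // => i.
  by move=> /negbTE ->; rewrite mulr0.
have pE j := poisson_equation (fun i => (i == j)%:R).
split.
  split=> // j; have [c [v hE]] := pE j.
  by rewrite pickE (poisson_mean t1 tT hE) (poisson_constant_ge0 j _ hE).
move=> t' [_ t'1 t'T]; apply/funext => j; have [c [v hE]] := pE j.
by rewrite !pickE (poisson_mean t1 tT hE) (poisson_mean t'1 t'T hE).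
Qed.

End FiniteChains.

(** * Means over the paths of a chain *)

Section PathMeans.
Context {R : realType} {X : finType} (L : X -> X -> R).

(** The conditional expectation of [F] applied to the next [n] letters, given that
    the current letter is [x]. *)
Definition path_mean (n : nat) (x : X) (F : seq X -> R) : R :=
  \sum_(w : n.-tuple X) transition_prod L (x :: w) * F w.

Lemma big_tuple_cons (n : nat) (f : n.+1.-tuple X -> R) :
  \sum_w f w = \sum_x \sum_(w : n.-tuple X) f [tuple of x :: w].
Proof.
rewrite pair_big /=.
rewrite (reindex (fun p : X * n.-tuple X => [tuple of p.1 :: p.2])) //=.
exists (fun w => (thead w, [tuple of behead w])) => [[x w] _|w _] /=.
  by congr pair; apply: val_inj.
by rewrite [RHS]tuple_eta.
Qed.

Lemma transition_prod_cons x y w :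
  transition_prod L [:: x, y & w] = L x y * transition_prod L (y :: w).
Proof. by rewrite /transition_prod /= big_cons. Qed.

Lemma path_mean0 x F : path_mean 0 x F = F [::].
Proof.
rewrite /path_mean (big_pred1 [tuple]) => [|w]; last first.
  by apply/esym/eqP; exact: tuple0.
by rewrite /transition_prod big_nil mul1r.
Qed.

Lemma path_meanS n x F :
  path_mean n.+1 x F = \sum_y L x y * path_mean n y (fun w => F (y :: w)).
Proof.
rewrite /path_mean big_tuple_cons; apply: eq_bigr => y _.
by rewrite mulr_sumr; apply: eq_bigr => w _; rewrite /= transition_prod_cons mulrA.
Qed.

Lemma eq_path_mean n x F G : (forall w, size w = n -> F w = G w) ->
  path_mean n x F = path_mean n x G.
Proof. by move=> FG; apply: eq_bigr => w _; rewrite FG ?size_tuple. Qed.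

Lemma path_meanZ n x c F :
  path_mean n x (fun w => c * F w) = c * path_mean n x F.
Proof. by rewrite /path_mean mulr_sumr; apply: eq_bigr => w _; rewrite mulrCA. Qed.

Lemma path_meanD n x F G :
  path_mean n x (fun w => F w + G w) = path_mean n x F + path_mean n x G.
Proof. by rewrite /path_mean -big_split; apply: eq_bigr => w _; rewrite mulrDr. Qed.

Lemma path_mean_sum n x (J : Type) (r : seq J) (F : J -> seq X -> R) :
  path_mean n x (fun w => \sum_(j <- r) F j w) =
  \sum_(j <- r) path_mean n x (F j).
Proof.
by rewrite /path_mean exchange_big; apply: eq_bigr => w _; rewrite mulr_sumr.
Qed.

(** Markov property. *)
Lemma path_mean_cat a b x F :
  path_mean (a + b) x F =
  path_mean a x (fun v => path_mean b (last x v) (fun w => F (v ++ w))).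
Proof.
elim: a x F => [|a IHa] x F; first by rewrite path_mean0.
by rewrite addSn !path_meanS; apply: eq_bigr => y _; rewrite IHa.
Qed.

Hypothesis stochL : stochastic L.

Lemma path_mean_cst n x c : path_mean n x (fun=> c) = c.
Proof.
elim: n x => [|n IHn] x; first by rewrite path_mean0.
rewrite path_meanS; under eq_bigr do rewrite IHn.
by rewrite -mulr_suml (proj2 stochL) mul1r.
Qed.

Lemma path_mean_le n x F G : (forall w, size w = n -> F w <= G w) ->
  path_mean n x F <= path_mean n x G.
Proof.
move=> FG; apply: ler_sum => w _; rewrite ler_wpM2l ?FG ?size_tuple //.
by apply: prodr_ge0 => p _; exact: (proj1 stochL).
Qed.

End PathMeans.

(** * Events that depend on a prefix *)

Section Cylinders.
Context {R : realType} {X : pointedFinType}.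

Lemma measurable_cylinder (w : seq X) :
  measurable (cylinder w : set (infword X)).
Proof.
have -> : cylinder w = \bigcap_(i in `I_(size w))
    ((fun omega : infword X => omega i) @^-1` [set nth point w i]).
  apply/seteqP; split=> omega /=.
    by move=> <- i /=; rewrite size_mkseq => iw; rewrite nth_mkseq.
  move=> wE; apply: (@eq_from_nth _ point); rewrite size_mkseq // => i iw.
  by rewrite nth_mkseq // wE.
rewrite bigcap_mkcond; apply: bigcap_measurable => [|i _]; first by exists 0.
case: ifP => // _; apply: sub_sigma_algebra.
apply: open_comp => [omega _|]; last exact: discrete_open.
exact: (@proj_continuous _ (fun=> discrete_topology X) i omega).
Qed.

Lemma word_event_bigcup (n : nat) (P : pred (seq X)) :
  [set omega : infword X | P (mkseq omega n)] =
  \bigcup_(w in [set w : n.-tuple X | P w]) cylinder w.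
Proof.
apply/seteqP; split=> omega /=; last first.
  by move=> [w Pw]; rewrite /cylinder /= size_tuple => ->.
move=> Pw; exists (Tuple (introT eqP (size_mkseq omega n))) => //=.
by rewrite /cylinder /= size_mkseq.
Qed.

Lemma measurable_word_event (n : nat) (P : pred (seq X)) :
  measurable [set omega : infword X | P (mkseq omega n)].
Proof.
rewrite word_event_bigcup; apply: fin_bigcup_measurable => [|w _].
  exact: finite_finset.
exact: measurable_cylinder.
Qed.

Lemma markov_word_event (L : X -> X -> R) (l : X -> R)
    (mu : probability (infword X) R) (n : nat) (P : pred (seq X)) :
    markov_measure L l mu ->
  mu [set omega | P (mkseq omega n.+1)] =
  (\sum_x l x * path_mean L n x (fun w => (P (x :: w))%:R))%:E.
Proof.
move=> hmu; rewrite word_event_bigcup measure_fin_bigcup.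
- rewrite (fsbigE (enum [pred w : n.+1.-tuple X | P w])) ?enum_uniq //; last first.
  + by move=> w /= Pw; rewrite mem_enum inE Pw.
  + by move=> w /=; rewrite mem_enum.
  transitivity (\sum_(w : n.+1.-tuple X | P w) mu (cylinder w)).
    rewrite big_enum_cond /=; apply: eq_bigl => w; rewrite andb_idr // => Pw.
    by rewrite inE.
  rewrite big_mkcond /=.
  transitivity (\sum_(w : n.+1.-tuple X)
      (l (thead w) * transition_prod L w * (P w)%:R)%:E).
    apply: eq_bigr => w _; case: ifP => _; last by rewrite mulr0.
    case/tupleP: w => x w; rewrite /= hmu /thead (tnth_nth x) /=.
    by rewrite mulr1.
  rewrite sumEFin big_tuple_cons; congr _%:E; apply: eq_bigr => x _.
  rewrite mulr_sumr; apply: eq_bigr => w _.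
  by rewrite /thead (tnth_nth x) /= mulrA.
- exact: finite_finset.
- move=> v w _ _ [omega []]; rewrite /cylinder /= !size_tuple => vE wE.
  by apply: val_inj; rewrite /= -vE -wE.
- by move=> w _; exact: measurable_cylinder.
Qed.

End Cylinders.

(** * Second moment of sums of centred window functions *)

Section WindowSums.
Context {R : realType} {X : finType} (L : X -> X -> R) (A : automaton X).
Hypothesis stochL : stochastic L.
Context (m : nat) (phi : A -> seq X -> R) (C : R).
Hypothesis phi_centered :
  forall s x, path_mean L m x (fun w => phi s (x :: w)) = 0.
Hypothesis phi_bounded : forall s w, `|phi s w| <= C.

(** A window has [m + 1] letters because [phi_centered] fixes the first one and
    averages over the [m] others. *)
Definition window_term (s : A) (i : nat) (w : seq X) : R :=
  phi (trans_word s (take i w)) (take m.+1 (drop i w)).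

Definition window_sum (s : A) (n : nat) (w : seq X) : R :=
  \sum_(0 <= i < n) window_term s i w.

Lemma window_term_cat s i v w : (i + m < size v)%N ->
  window_term s i (v ++ w) = window_term s i v.
Proof.
move=> imv; have iv : (i < size v)%N := leq_ltn_trans (leq_addr m i) imv.
rewrite /window_term take_cat iv drop_cat iv takel_cat //.
by rewrite size_drop ltn_subRL.
Qed.

(** The first window is contained in the first [j + 1] letters, so it may share
    with the second one only the letter [j].  These letters being fixed, the second
    factor has mean zero. *)
Lemma window_term_orthogonal s x N i j : (i + m <= j)%N -> (j + m <= N)%N ->
  path_mean L N x
    (fun w => window_term s i (x :: w) * window_term s j (x :: w)) = 0.
Proof.
move=> imj jmN; rewrite -(subnKC jmN) -addnA; set r := (N - _)%N.
rewrite path_mean_cat -[RHS](path_mean_cst stochL j x 0).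
apply: eq_path_mean => v sv; set y := last x v.
(* The prefix [x :: v] has length [j + 1] and ends with [y]; the next [m]
   letters [w1] complete the second window and the rest is irrelevant. *)
rewrite -[RHS](mulr0 (window_term s i (x :: v))).
rewrite -[X in _ = _ * X](phi_centered (trans_word s (belast x v)) y).
rewrite -path_meanZ path_mean_cat; apply: eq_path_mean => w1 sw1.
rewrite -[RHS](path_mean_cst stochL r (last y w1)).
apply: eq_path_mean => w2 _; rewrite -cat_cons window_term_cat ?sv //=.
congr (_ * _); rewrite /window_term.
have -> : x :: v ++ w1 ++ w2 = belast x v ++ (y :: w1) ++ w2.
  by rewrite -cat_cons lastI cat_rcons.
have sb : size (belast x v) = j by rewrite size_belast.
rewrite take_cat drop_cat sb ltnn subnn take0 drop0 cats0 /=.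
by rewrite take_cat sw1 ltnn subnn take0 cats0.
by rewrite ltnS sv.
Qed.

Lemma card_overlapping_windows n i :
  (\sum_(0 <= j < n) ((i < j + m) && (j < i + m)) <= m + m)%N.
Proof.
have -> : (\sum_(0 <= j < n) ((i < j + m) && (j < i + m)))%N =
    count (fun j => (i < j + m) && (j < i + m))%N (index_iota 0 n).
  by rewrite -sum1_count [RHS]big_mkcond; apply: eq_bigr => j _; case: ifP.
rewrite -size_filter -(size_iota (i - m) (m + m)).
apply: uniq_leq_size; first by rewrite filter_uniq ?iota_uniq.
by move=> j; rewrite mem_filter mem_iota => /andP[/andP[]]; lia.
Qed.

(** In the expansion of the square only the pairs of windows at distance less
    than [m] survive: at most [2 m] for each of the [n] windows. *)
Lemma window_sum_second_moment s x n :
  path_mean L (n + m) x (fun w => window_sum s n (x :: w) ^+ 2) <=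
  n%:R * ((m + m)%:R * C ^+ 2).
Proof.
have C0 : 0 <= C by exact: le_trans (normr_ge0 _) (phi_bounded s [::]).
have termC i w : `|window_term s i w| <= C by exact: phi_bounded.
under eq_path_mean => w _.
  rewrite expr2 {1}/window_sum mulr_suml.
  under eq_bigr do rewrite /window_sum mulr_sumr. over.
rewrite path_mean_sum.
have -> : n%:R * ((m + m)%:R * C ^+ 2) =
    \sum_(0 <= i < n) ((m + m)%:R * C ^+ 2).
  by rewrite big_const_nat subn0 iter_addr_0 mulr_natl.
rewrite big_seq [leRHS]big_seq; apply: ler_sum => i.
rewrite mem_index_iota /= => iltn; rewrite path_mean_sum.
apply: (@le_trans _ _
  (\sum_(0 <= j < n) ((i < j + m) && (j < i + m))%N%:R * C ^+ 2)); last first.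
  rewrite -mulr_suml ler_wpM2r ?sqr_ge0 // -natr_sum ler_nat.
  exact: card_overlapping_windows.
rewrite big_seq [leRHS]big_seq; apply: ler_sum => j.
rewrite mem_index_iota /= => jltn.
case: ltnP => [ij|ji] /=; last first.
  under eq_path_mean do rewrite mulrC.
  by rewrite window_term_orthogonal ?mul0r // leq_add2r ltnW.
case: ltnP => [ji|ij'] /=; last first.
  by rewrite window_term_orthogonal ?mul0r // leq_add2r ltnW.
rewrite mul1r -(path_mean_cst stochL (n + m) x (C ^+ 2)).
apply: path_mean_le => // w _; apply: le_trans (ler_norm _) _.
by rewrite normrM expr2 ler_pM.
Qed.

End WindowSums.

(** * A strong law of large numbers from second moments *)

Section StrongLaw.

(** By comparison with the telescoping sum of [1 / i - 1 / i.+1]. *)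
Lemma sum_inv_squares_le {R : realFieldType} n :
  \sum_(0 <= i < n) (i.+1%:R ^+ 2)^-1 <= 2 :> R.
Proof.
case: n => [|n]; first by rewrite big_nil.
suff : \sum_(0 <= i < n.+1) (i.+1%:R ^+ 2)^-1 <= 2 - n.+1%:R^-1 :> R.
  by move=> /le_trans; apply; rewrite gerBl invr_ge0.
elim: n => [|n IHn]; first by rewrite big_nat1 expr1n invr1; lra.
rewrite big_nat_recr //=; apply: le_trans (lerD IHn (lexx _)) _.
have n0 : 0 < n.+1%:R :> R by rewrite ltr0n.
have -> : n.+2%:R = n.+1%:R + 1 :> R by rewrite -natr1.
set a := n.+1%:R in n0 *.
have a1 : 0 < a + 1 by lra.
rewrite -subr_ge0.
have -> : 2 - (a + 1)^-1 - (2 - a^-1 + ((a + 1) ^+ 2)^-1) =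
   (a * (a + 1) ^+ 2)^-1 by field; rewrite !gt_eqF.
by rewrite invr_ge0 mulr_ge0 ?sqr_ge0 ?ltW.
Qed.

Lemma exists_sqrtn n : exists r, (r ^ 2 <= n < r.+1 ^ 2)%N.
Proof.
elim: n => [|n [r /andP[rn nr]]]; first by exists 0%N.
case: (leqP (r.+1 ^ 2) n.+1) => h; [exists r.+1|exists r]; lia.
Qed.

(** Between the squares of [r] and [r + 1] there are only [O(r)] steps, each of
    size at most [C], while [n] is of order [r ^ 2]. *)
Lemma cvg_mean0_squares {R : realType} (S : nat -> R) (C : R) :
    (forall n, `|S n.+1 - S n| <= C) ->
    (forall e : R, 0 < e ->
      \forall r \near \oo, `|S (r.+1 ^ 2)%N| < e * (r.+1 ^ 2)%:R) ->
  (fun n : nat => n%:R^-1 * S n) @ \oo --> (0 : R).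
Proof.
move=> incS Ssq; have C0 : 0 <= C by exact: le_trans (normr_ge0 _) (incS 0%N).
have gap n k : `|S (n + k)%N - S n| <= k%:R * C.
  elim: k => [|k IHk]; first by rewrite addn0 subrr normr0 mul0r.
  rewrite addnS -natr1 mulrDl mul1r [leRHS]addrC.
  rewrite -[S (n + k).+1](subrK (S (n + k)%N)) -addrA.
  by apply: le_trans (ler_normD _ _) _; rewrite lerD.
apply/cvgrPdist_lt => e e0.
have [r0 _ Hr0] := Ssq (e / 2) (divr_gt0 e0 (ltr0n _ 2)).
(* With [r.+1 ^ 2 <= n < r.+2 ^ 2], the variation since [r.+1 ^ 2] is at most
   [3 * r.+1 * C], and this is at most [e / 2 * r.+1 ^ 2] once
   [6 * C / e <= r.+1]. *)
pose r1 := Num.truncn (6 * C / e).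
exists ((maxn r0 r1).+2 ^ 2)%N => // n /= Hn.
have [[|r] /andP[rn nr]] := exists_sqrtn n; first by lia.
have rr1 : (maxn r0 r1 < r)%N.
  by rewrite ltnNge; apply/negP => rle; have : (r.+2 ^ 2 <= (maxn r0 r1).+2 ^ 2)%N;
   [rewrite leq_exp2r //|lia].
have Sr : `|S (r.+1 ^ 2)%N| < e / 2 * (r.+1 ^ 2)%:R by apply: Hr0 => /=; lia.
have n0 : 0 < n%:R :> R by rewrite ltr0n; lia.
rewrite sub0r normrN normrM normfV normr_nat mulrC ltr_pdivrMr //.
have Cr : 6 * C <= e * r.+1%:R.
  rewrite -ler_pdivrMl // mulrC; apply: ltW.
  apply: lt_le_trans (truncnS_gt _) _.
  by rewrite ler_nat ltnS; exact: leq_trans (leq_maxr r0 r1) (ltnW rr1).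
have -> : n = (r.+1 ^ 2 + (n - r.+1 ^ 2))%N by lia.
set k := (n - _)%N; have kr : (k <= 3 * r.+1)%N by lia.
have := gap (r.+1 ^ 2)%N k.
set b := S (_ + _)%N; set a := S _ in Sr *.
have : k%:R * C <= 3 * r.+1%:R * C.
  by rewrite ler_wpM2r // -natrM ler_nat.
have : 3 * r.+1%:R * C <= e / 2 * (r.+1 ^ 2)%:R.
  rewrite natrX; have : 0 <= r.+1%:R :> R by []. nra.
have : e * (r.+1 ^ 2)%:R <= e * (r.+1 ^ 2 + k)%:R.
  by rewrite ler_pM2l // ler_nat leq_addr.
have : `|b| <= `|a| + `|b - a|.
  by rewrite -{1}(subrK a b) addrC; exact: ler_normD.
lra.
Qed.

Lemma cvg_mean_bounded (R : realType) (f : nat -> R) (B : R) :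
  (forall n, `|f n| <= B) -> (fun n : nat => n%:R^-1 * f n) @ \oo --> (0 : R).
Proof.
move=> fB; apply: (@cvg_mean0_squares _ f (B + B)) => [n|e e0].
  by apply: le_trans (ler_normB _ _) _; rewrite lerD.
exists (Num.truncn (B / e)) => // r /= Br.
apply: le_lt_trans (fB _) _; rewrite mulrC -ltr_pdivrMr //.
apply: lt_le_trans (truncnS_gt _) _; rewrite ler_nat.
apply: leq_trans (_ : r.+1 <= _)%N; first by rewrite ltnS.
by rewrite -[leqLHS]expn1 leq_pexp2l.
Qed.

(** Along the squares the bounds on the deviations are summable, so by
    Borel-Cantelli for each [e] almost surely [`|S (r ^ 2)| < e * r ^ 2] for all
    large [r].  Letting [e] run through a sequence that tends to 0 keeps the
    exceptional set negligible, and the bound on the increments fills the gaps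
    between the squares. *)
Lemma strong_law_of_deviations (R : realType) (d : measure_display)
    (Om : measurableType d) (mu : {measure set Om -> \bar R})
    (S : nat -> Om -> R) (C K : R) :
    (forall n (e : R), measurable [set omega | (e * n%:R <= `|S n omega|)%R]) ->
    (forall n (e : R), (0 < n)%N -> 0 < e ->
      (mu [set omega | (e * n%:R <= `|S n omega|)%R] <=
        (K / (e ^+ 2 * n%:R))%:E)%E) ->
    (forall n omega, `|S n.+1 omega - S n omega| <= C) ->
  {ae mu, forall omega, (fun n : nat => n%:R^-1 * S n omega) @ \oo --> (0 : R)}.
Proof.
move=> mS devS incS.
pose F e r : set Om := [set omega | e * (r.+1 ^ 2)%:R <= `|S (r.+1 ^ 2)%N omega|].
have F0 e : 0 < e -> mu (lim_sup_set (F e)) = 0%E.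
  move=> e0; apply: lim_sup_set_cvg0 => [r|]; first exact: mS.
  have K0 : 0 <= K.
    have := le_trans (measure_ge0 mu _) (devS 1%N 1 isT ltr01).
    by rewrite lee_fin expr1n mulr1 divr1.
  apply: (@le_lt_trans _ _ (K / e ^+ 2 * 2)%:E); last exact: ltry.
  apply: lime_le; first by apply: is_cvg_nneseries.
  apply: nearW => n.
  apply: (@le_trans _ _
      (\sum_(0 <= r < n) (K / e ^+ 2 * (r.+1%:R ^+ 2)^-1)%:E)%E).
    apply: lee_sum => r _; apply: le_trans (devS _ _ _ e0) _ => //.
    by rewrite lee_fin natrX invfM mulrA.
  rewrite sumEFin lee_fin -mulr_sumr ler_wpM2l ?sum_inv_squares_le //.
  by rewrite divr_ge0 ?sqr_ge0.
pose e_ j : R := j.+1%:R^-1.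
have e_gt0 j : 0 < e_ j by rewrite invr_gt0.
have mF e r : measurable (F e r) by exact: mS.
have : mu.-negligible (\bigcup_j lim_sup_set (F (e_ j))).
  apply: negligible_bigcup => j; apply/negligibleP; last exact: F0.
  by apply: bigcap_measurable => [|n _]; [exists 0%N|apply: bigcup_measurable].
apply: negligibleS => omega /= nS0.
apply: contrapT => nF; apply: nS0.
apply: (@cvg_mean0_squares _ (S ^~ omega) C) => // e e0.
have [j je] : exists j, e_ j < e.
  exists (Num.truncn e^-1).
  by rewrite /e_ -[ltRHS]invrK ltf_pV2 ?posrE ?invr_gt0 // truncnS_gt.
have : ~ lim_sup_set (F (e_ j)) omega by move=> Fj; apply: nF; exists j.
rewrite /lim_sup_set /bigcap /= -existsNP => -[n nFn].
exists n => // r /= nr; rewrite ltNge; apply/negP => er.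
apply: nFn => _; exists r => //=; apply: le_trans er.
by rewrite ler_wpM2r // ltW.
Qed.

End StrongLaw.

(** * The automaton along an infinite word *)

Section InfiniteWords.
Context {X : pointedFinType} (A : automaton X).

Lemma iter_wshift i (omega : infword X) j :
  iter i (@wshift X) omega j = omega (i + j)%N.
Proof. by elim: i j => // i IHi j; rewrite iterS /wshift IHi addSnnS. Qed.

Lemma mkseq_cons (T : Type) (f : nat -> T) n :
  mkseq f n.+1 = f 0%N :: mkseq (fun i => f i.+1) n.
Proof. by rewrite /mkseq /= -[1%N]/(1 + 0)%N iotaDl -map_comp. Qed.

Lemma trans_word_rcons (s : A) w x :
  trans_word s (rcons w x) = trans (trans_word s w) x.
Proof. by elim: w s => //= y w IHw s; rewrite IHw. Qed.

(** Reading commutes with the shift, provided that the automaton restarts in the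
    state it had reached. *)
Lemma iter_wshift_out_inf i (s : A) (omega : infword X) :
  iter i (@wshift X) (out_inf s omega) =
  out_inf (trans_word s (mkseq omega i)) (iter i (@wshift X) omega).
Proof.
elim: i s omega => [//|i IHi] s omega; rewrite 2!iterSr mkseq_cons /= -IHi.
by congr iter; apply/funext => n; rewrite /wshift out_infS.
Qed.

Lemma mkseq_out_inf n (s : A) (omega : infword X) :
  mkseq (out_inf s omega) n = out_word s (mkseq omega n).
Proof.
elim: n s omega => [//|n IHn] s omega; rewrite !mkseq_cons /= -IHn.
by congr cons; apply: eq_mkseq => i; exact: out_infS.
Qed.

Lemma window_sum_mkseq (R : realType) m (phi : A -> seq X -> R) s n N
    (omega : infword X) : (n + m <= N)%N ->
  window_sum m phi s n (mkseq omega N) =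
  \sum_(0 <= i < n) phi (trans_word s (mkseq omega i))
                        (mkseq (iter i (@wshift X) omega) m.+1).
Proof.
move=> nmN; rewrite /window_sum big_seq [RHS]big_seq; apply: eq_bigr => i.
rewrite mem_index_iota /window_term /mkseq => /= iltn; congr phi.
  by rewrite -map_take take_iota (minn_idPl _) //; lia.
rewrite -map_drop drop_iota -map_take take_iota (minn_idPl _); last by lia.
rewrite add0n -{1}[i]addn0 iotaDl -map_comp.
by apply: eq_map => j /=; rewrite iter_wshift.
Qed.

End InfiniteWords.

(** * The strong law for window functions *)

Section MarkovWindows.
Context {R : realType} {X : pointedFinType} (L : X -> X -> R) (l : X -> R).
Context (mu : probability (infword X) R) (A : automaton X).
Hypotheses (stochL : stochastic L) (l_ge0 : forall x, 0 <= l x).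
Hypotheses (l_sum1 : \sum_x l x = 1) (hmu : markov_measure L l mu).
Context (m : nat) (phi : A -> seq X -> R) (C : R).
Hypothesis phi_centered :
  forall s x, path_mean L m x (fun w => phi s (x :: w)) = 0.
Hypothesis phi_bounded : forall s w, `|phi s w| <= C.

(** Chebyshev's inequality, applied to the finite sum that gives the probability
    of an event on the first [n + m + 1] letters. *)
Lemma window_sum_deviation s n (e : R) : (0 < n)%N -> 0 < e ->
  (mu [set omega | (e * n%:R <=
                    `|window_sum m phi s n (mkseq omega (n + m).+1)|)%R] <=
   ((m + m)%:R * C ^+ 2 / (e ^+ 2 * n%:R))%:E)%E.
Proof.
move=> n0 e0; have nR : 0 < n%:R :> R by rewrite ltr0n.
have en0 : 0 < e * n%:R by rewrite mulr_gt0.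
pose P w := e * n%:R <= `|window_sum m phi s n w|.
rewrite (markov_word_event (n + m) P hmu) lee_fin.
set K := (m + m)%:R * C ^+ 2.
have -> : K / (e ^+ 2 * n%:R) = \sum_x l x * ((e * n%:R) ^- 2 * (n%:R * K)).
  rewrite -mulr_suml l_sum1 mul1r; field.
  by rewrite !gt_eqF.
apply: ler_sum => x _; apply: ler_wpM2l => //.
have secm := window_sum_second_moment stochL phi_centered phi_bounded s x n.
apply: (@le_trans _ _ ((e * n%:R) ^- 2 *
    path_mean L (n + m) x (fun w => window_sum m phi s n (x :: w) ^+ 2))).
  rewrite -path_meanZ; apply: path_mean_le => // w _; rewrite /P.
  case: (leP (e * n%:R) _) => [Pw|_]; last first.
    by rewrite mulr_ge0 ?invr_ge0 ?sqr_ge0.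
  rewrite -ler_pdivrMl ?invr_gt0 ?exprn_gt0 // invrK mulr1.
  by rewrite -[leRHS]real_normK ?num_real // lerXn2r ?nnegrE ?normr_ge0 // ltW.
by rewrite ler_wpM2l // invr_ge0 sqr_ge0.
Qed.

Lemma window_strong_law s :
  {ae mu, forall omega, (fun n : nat => n%:R^-1 *
      \sum_(0 <= i < n) phi (trans_word s (mkseq omega i))
                            (mkseq (iter i (@wshift X) omega) m.+1))
    @ \oo --> (0 : R)}.
Proof.
pose S n (omega : infword X) := window_sum m phi s n (mkseq omega (n + m).+1).
have SE n omega : \sum_(0 <= i < n) phi (trans_word s (mkseq omega i))
    (mkseq (iter i (@wshift X) omega) m.+1) = S n omega.
  by rewrite /S window_sum_mkseq.
have : {ae mu, forall omega,
    (fun n : nat => n%:R^-1 * S n omega) @ \oo --> (0 : R)}.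
  apply: (@strong_law_of_deviations _ _ _ _ S C ((m + m)%:R * C ^+ 2)).
  - move=> n e; apply: (@measurable_word_event X (n + m).+1
      (fun w => e * n%:R <= `|window_sum m phi s n w|)).
  - by move=> n e; exact: window_sum_deviation.
  - by move=> n omega; rewrite -!SE big_nat_recr //= addrAC subrr add0r.
apply: filterS => omega; apply: cvg_trans; apply: near_eq_cvg.
by apply: nearW => n; rewrite SE.
Qed.

End MarkovWindows.

(** * The chain of states and letters *)

Lemma sum_pair (R : nmodType) (I J : finType) (F : I * J -> R) :
  \sum_p F p = \sum_i \sum_j F (i, j).
Proof. by rewrite pair_bigA; apply: eq_bigr => -[]. Qed.

Lemma norm_le_sum_norm (R : numDomainType) (I : finType) (v : I -> R) i :
  `|v i| <= \sum_j `|v j|.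
Proof. by rewrite (bigD1 i) //= lerDl sumr_ge0. Qed.

Section TransitionMatrix.
Context {R : realType} {X : finType} (L : X -> X -> R) (A : automaton X).

Lemma transition_matrix_apply (v : A * X -> R) s x :
  \sum_q transition_matrix L (s, x) q * v q =
  \sum_y L x y * v (trans s x, y).
Proof.
rewrite sum_pair (bigD1 (trans s x)) //= [X in _ + X]big1 ?addr0 => [|r rs].
  by apply: eq_bigr => y _; rewrite /transition_matrix eqxx.
by apply: big1 => y _; rewrite /transition_matrix /= eq_sym (negbTE rs) mul0r.
Qed.

Lemma transition_matrix_connect : strongly_connected A L ->
  forall p q, connect (fun a b => transition_matrix L (A := A) a b != 0) p q.
Proof.
move=> sc [s x] [r y]; have [w [+ +]] := sc s r x y.
elim: w s x => [|z w IHw] s x /=.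
  move=> <- /andP[xy _]; apply: connect1.
  by rewrite /transition_matrix /= eqxx.
move=> wr /andP[xz wy]; apply: connect_trans (IHw _ _ wr wy).
by apply: connect1; rewrite /transition_matrix /= eqxx.
Qed.

End TransitionMatrix.

(** * Occurrences of a word in the output *)

Section WordFrequency.
Context {R : realType} {X : pointedFinType} (L : X -> X -> R) (A : automaton X).
Hypothesis stochL : stochastic L.
Context (k : nat) (u : k.+1.-tuple X).

Definition word_prob (p : A * X) : R :=
  path_mean L k p.2 (fun w => (out_word p.1 (p.2 :: w) == u)%:R).

Lemma sum_word_prob (t : A * X -> R) :
  \sum_p t p * word_prob p =
  \sum_(s0 : A) \sum_(x : k.+1.-tuple X | out_word s0 x == u)
     t (s0, thead x) * transition_prod L x.
Proof.
rewrite sum_pair; apply: eq_bigr => s _; rewrite [RHS]big_mkcond big_tuple_cons.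
apply: eq_bigr => x _; rewrite mulr_sumr; apply: eq_bigr => w _.
rewrite /thead (tnth_nth x) /=.
by case: ifP => _; rewrite ?mulr1 // !mulr0.
Qed.

Context (c : R) (v : A * X -> R).

(** The indicator of [u] being written, minus [c], plus the increment of [v] over
    one step of the chain: when [v] solves the Poisson equation for [word_prob] with
    constant [c], its conditional mean is zero.  The window has [k + 2] letters,
    one more than [u], because the increment of [v] uses the letter after the first
    even when [u] has a single letter. *)
Definition centered_count (s : A) (w : seq X) : R :=
  (out_word s (take k.+1 w) == u)%:R - c - v (s, head point w)
  + v (trans s (head point w), head point (behead w)).

Lemma centered_countE s w :
  (out_word s (take k.+1 w) == u)%:R = centered_count s w + c +
  (v (s, head point w) - v (trans s (head point w), head point (behead w))).
Proof. by rewrite /centered_count; ring. Qed.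

Lemma centered_count_bounded s w :
  `|centered_count s w| <= 1 + `|c| + \sum_p `|v p| + \sum_p `|v p|.
Proof.
have vle := norm_le_sum_norm v.
rewrite /centered_count; apply: le_trans (ler_normD _ _) _; apply: lerD => //.
apply: le_trans (ler_normB _ _) _; apply: lerD => //.
apply: le_trans (ler_normB _ _) _; apply: lerD => //.
by case: (_ == _); rewrite ?normr1 ?normr0.
Qed.

Hypothesis poisson_v : forall p,
  word_prob p = c + (v p - \sum_q transition_matrix L p q * v q).

Lemma centered_count_mean s x :
  path_mean L k.+1 x (fun w => centered_count s (x :: w)) = 0.
Proof.
have -> : path_mean L k.+1 x (fun w => centered_count s (x :: w)) =
    path_mean L k.+1 x (fun w => (out_word s (x :: take k w) == u)%:R)
    + path_mean L k.+1 x (fun=> - c - v (s, x))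
    + path_mean L k.+1 x (fun w => v (trans s x, head point w)).
  by rewrite -!path_meanD; apply: eq_path_mean => w _; rewrite /centered_count addrA.
have -> : path_mean L k.+1 x (fun w => (out_word s (x :: take k w) == u)%:R) =
    word_prob (s, x).
  have := path_mean_cat L k 1 x
    (fun w => (out_word s (x :: take k w) == u)%:R).
  rewrite addn1 => ->; apply: eq_path_mean => w sw.
  rewrite -[RHS](path_mean_cst stochL 1 (last x w)); apply: eq_path_mean => z _.
  by rewrite take_cat sw ltnn subnn take0 cats0.
have -> : path_mean L k.+1 x (fun w => v (trans s x, head point w)) =
    \sum_y L x y * v (trans s x, y).
  rewrite path_meanS; apply: eq_bigr => y _; congr (_ * _).
  by rewrite -[RHS](path_mean_cst stochL k y).
rewrite path_mean_cst // poisson_v transition_matrix_apply; ring.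
Qed.

(** The increments of [v] telescope along the trajectory. *)
Lemma sum_indic_out_inf s n (omega : infword X) :
  \sum_(0 <= i < n) \1_(cylinder u) (iter i (@wshift X) (out_inf s omega)) =
  \sum_(0 <= i < n) centered_count (trans_word s (mkseq omega i))
                      (mkseq (iter i (@wshift X) omega) k.+2)
  + n%:R * c + (v (s, omega 0%N) - v (trans_word s (mkseq omega n), omega n)) :> R.
Proof.
pose Z i := (trans_word s (mkseq omega i), omega i).
have -> : n%:R * c = \sum_(0 <= i < n) c :> R.
  by rewrite big_const_nat subn0 iter_addr_0 mulr_natl.
have -> : v (s, omega 0%N) - v (trans_word s (mkseq omega n), omega n) =
    \sum_(0 <= i < n) (v (Z i) - v (Z i.+1)).
  have := telescope_sumr (fun i => - v (Z i)) (leq0n n).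
  rewrite opprK addrC => <-; apply: eq_bigr => i _.
  by rewrite opprK addrC.
rewrite -!big_split /=; apply: eq_bigr => i _.
have cylE (xi : infword X) : (xi \in cylinder u) = (mkseq xi k.+1 == u).
  by apply/idP/eqP; rewrite inE /cylinder /= size_tuple.
rewrite indicE cylE iter_wshift_out_inf mkseq_out_inf.
set si := trans_word _ _; set win := mkseq _ k.+2.
have -> : mkseq (iter i (@wshift X) omega) k.+1 = take k.+1 win.
  by rewrite /win /mkseq -map_take take_iota (minn_idPl _).
rewrite centered_countE; congr (_ + _ + (v _ - v _)).
  by rewrite /Z /win mkseq_cons /= iter_wshift addn0.
rewrite /Z (mkseqS omega i) trans_word_rcons /win !mkseq_cons /=.
by rewrite !iter_wshift addn0 addn1.
Qed.

End WordFrequency.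

Theorem theorem4p8 (R : realType) (X : pointedFinType) (hX : (1 < #|X|)%N)
    (L : X -> X -> R) (l : X -> R)
    (hL : stochastic L) (irrL : irreducible L)
    (hl : stationary_distribution L l)
    (mu : probability (infword X) R) (hmu : markov_measure L l mu)
    (A : automaton X) (g : infword X -> infword X) (hg : generated_by A g)
    (hA : strongly_connected A L) :
  exists t : A * X -> R,
    unique (stationary_distribution (transition_matrix (A := A) L)) t /\
    forall (k : nat) (u : k.+1.-tuple X),
      {ae mu, forall omega : infword X,
        (fun n : nat => n%:R^-1 *
           \sum_(0 <= i < n) \1_(cylinder u) (iter i (@wshift X) (g omega)))
          @ \oo -->
        \sum_(s0 : A) \sum_(x : k.+1.-tuple X | out_word s0 x == u)
           t (s0, thead x) * transition_prod L x}.
Proof.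
have [s gE] := hg; have [l0 l1 _] := hl.
have stochT := transition_matrix_stochastic A hL.
have connT := transition_matrix_connect hA.
have [t tU] := stationary_distribution_unique stochT connT (s, point).
exists t; split=> // k u; have [[t0 t1 tT] _] := tU.
have [c [v hv]] := poisson_equation stochT connT (word_prob L u).
rewrite -sum_word_prob (poisson_mean t1 tT hv).
have := window_strong_law hL l0 l1 hmu
  (centered_count_mean hL hv) (centered_count_bounded u c v) s.
apply: (@filterS _ _ (ae_filter_ringOfSetsType mu)) => omega phi0.
pose d n := v (s, omega 0%N) - v (trans_word s (mkseq omega n), omega n).
have d0 : (fun n : nat => n%:R^-1 * d n) @ \oo --> (0 : R).
  apply: (@cvg_mean_bounded _ d (\sum_p `|v p| + \sum_p `|v p|)) => n.
  by have vle := norm_le_sum_norm v; apply: le_trans (ler_normB _ _) _; rewrite lerD.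
rewrite -[X in _ --> X](addr0 c) -[X in _ --> X + _](add0r c).
apply: cvg_trans (cvgD (cvgD phi0 (cvg_cst c)) d0); apply: near_eq_cvg.
exists 1%N => // n /= n0.
rewrite gE (sum_indic_out_inf u c v) -/(d n) 2!mulrDr mulKf //.
by rewrite pnatr_eq0 -lt0n.
Qed.
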